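(* Let $h' \in \mathfrak{sl}(2,\mathbb{C})$ be a matrix with $\det(h') = -1$. Then there exists an invertible $2\times 2$ complex matrix $A$ such that $A h A^{-1} = h'$. Moreover, for such an $A$, putting $e_1' = A e_1 A^{-1}$ and $e_2' = A e_2 A^{-1}$, the elements $h', e_1', e_2'$ satisfy $$[e_1', e_2'] = h', \quad [h', e_1'] = 2e_1', \quad [h', e_2'] = -2e_2'.$$
   Context: $\mathfrak{sl}(2,\mathbb{C})$ is the Lie algebra of traceless $2\times 2$ complex matrices with bracket $[x,y]=xy-yx$. Its canonical basis is $h=\begin{pmatrix}1&0\\0&-1\end{pmatrix}$, $e_1=\begin{pmatrix}0&1\\0&0\end{pmatrix}$, $e_2=\begin{pmatrix}0&0\\1&0\end{pmatrix}$. *)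

(* Defs.v *)
From mathcomp Require Import all_boot all_order all_algebra.
From mathcomp Require Import reals.
From mathcomp.real_closed Require Export complex.

Set Implicit Arguments.
Unset Strict Implicit.
Unset Printing Implicit Defensive.

Import GRing.Theory.
Local Open Scope ring_scope.

Section Sl2.
Variable R : realType.
Implicit Types x y A : 'M[R[i]]_2.

Definition sl2 : {pred 'M[R[i]]_2} := [pred x | \tr x == 0].

Definition lie_bracket x y : 'M[R[i]]_2 := x *m y - y *m x.

Definition sl2_h : 'M[R[i]]_2 := delta_mx 0 0 - delta_mx 1 1.
Definition sl2_e1 : 'M[R[i]]_2 := delta_mx 0 1.
Definition sl2_e2 : 'M[R[i]]_2 := delta_mx 1 0.

Definition conj_mx A x : 'M[R[i]]_2 := A *m x *m invmx A.

Lemma sl2_h_in : sl2_h \in sl2.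
Proof. by rewrite inE /mxtrace !big_ord_recl big_ord0 !mxE /= subr0 sub0r addr0 subrr. Qed.

Lemma sl2_e1_in : sl2_e1 \in sl2.
Proof. by rewrite inE /mxtrace !big_ord_recl big_ord0 !mxE /= !addr0. Qed.

Lemma sl2_e2_in : sl2_e2 \in sl2.
Proof. by rewrite inE /mxtrace !big_ord_recl big_ord0 !mxE /= !addr0. Qed.

Lemma sl2_lie_bracket x y : lie_bracket x y \in sl2.
Proof. by rewrite inE /lie_bracket linearB /= mxtrace_mulC subrr. Qed.

Lemma sl2_conj_mx A x : A \in unitmx -> x \in sl2 -> conj_mx A x \in sl2.
Proof. by move=> Au; rewrite !inE /conj_mx mxtrace_mulC mulmxA mulVmx // mul1mx. Qed.

End Sl2.

Arguments sl2 {R}.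
Arguments sl2_h {R}.
Arguments sl2_e1 {R}.
Arguments sl2_e2 {R}.

(* Main.v *)
Require Import Defs.
From mathcomp Require Import all_boot all_order all_algebra.
From mathcomp Require Import reals.
From mathcomp Require Import ring.

Import GRing.Theory Num.Theory.

Local Open Scope ring_scope.

(** By Cayley-Hamilton, a traceless 2 x 2 matrix of determinant -1 is an
    involution, and so is [sl2_h].  For two involutions [g] and [h] and any
    matrix [M], the sum [M + g *m M *m h], fixed by the map [X |-> g *m X *m h],
    intertwines [g] and [h], so it conjugates [h] to [g] as soon as it is
    invertible.  Writing [a] for the top left entry of [h'], the choices
    [M = 1] and [M = sl2_e1 + sl2_e2] give the determinants [2 * (1 + a)] and
    [- 2 * (1 - a)], and these cannot both vanish.

    The bracket relations hold for [sl2_h], [sl2_e1], [sl2_e2] by computation,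
    and they are carried over to the primed elements because conjugation is a
    linear map that preserves the bracket. *)

Lemma intertwiner_involutions (S : pzRingType) n (g h M : 'M[S]_n) :
  g *m g = 1%:M -> h *m h = 1%:M ->
  g *m (M + g *m M *m h) = (M + g *m M *m h) *m h.
Proof.
move=> gg hh.
by rewrite mulmxDr mulmxDl !mulmxA gg mul1mx -[g *m M *m h *m h]mulmxA hh
  mulmx1 addrC.
Qed.

Lemma matrix2P (T : Type) (A B : 'M[T]_2) :
  [/\ A 0 0 = B 0 0, A 0 1 = B 0 1, A 1 0 = B 1 0 & A 1 1 = B 1 1] -> A = B.
Proof.
move=> [E00 E01 E10 E11]; apply/matrixP => i j.
have ord2 (k : 'I_2) : k = 0 \/ k = 1.
  by case: k => [[|[|//]] lt_k]; [left | right]; apply: val_inj.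
by case: (ord2 i) => ->; case: (ord2 j) => ->.
Qed.

Lemma mulmx2E (S : pzSemiRingType) (A B : 'M[S]_2) i j :
  (A *m B) i j = A i 0 * B 0 j + A i 1 * B 1 j.
Proof.
rewrite mxE !big_ord_recl big_ord0 addr0.
by have -> : lift ord0 ord0 = 1 :> 'I_2 by apply: val_inj.
Qed.

Lemma mxtrace2E (S : pzSemiRingType) (A : 'M[S]_2) : \tr A = A 0 0 + A 1 1.
Proof.
rewrite /mxtrace !big_ord_recl big_ord0 addr0.
by have -> : lift ord0 ord0 = 1 :> 'I_2 by apply: val_inj.
Qed.

Lemma det2E (S : comPzRingType) (A : 'M[S]_2) :
  \det A = A 0 0 * A 1 1 - A 0 1 * A 1 0.
Proof.
rewrite (expand_det_row _ 0) !big_ord_recl big_ord0 addr0 /cofactor !det_mx11.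
rewrite !mxE /= expr0 expr1 mul1r mulN1r mulrN.
by congr (A _ _ * A _ _ - A _ _ * A _ _); apply: val_inj.
Qed.

(** The Cayley-Hamilton identity for a matrix of trace 0. *)
Lemma sqr_traceless2 (S : comNzRingType) (x : 'M[S]_2) :
  \tr x = 0 -> x *m x = (- \det x)%:M.
Proof.
rewrite mxtrace2E => /eqP; rewrite addrC addr_eq0 => /eqP x11.
by apply: matrix2P; split; rewrite mulmx2E !mxE det2E /= x11; ring.
Qed.

Section Conjugation.
Variable R : realType.
Implicit Types A x y : 'M[R[i]]_2.

Lemma conj_mxZ A c x : conj_mx A (c *: x) = c *: conj_mx A x.
Proof. by rewrite /conj_mx -scalemxAr -scalemxAl. Qed.

Lemma lie_bracket_conj A x y : A \in unitmx ->
  lie_bracket (conj_mx A x) (conj_mx A y) = conj_mx A (lie_bracket x y).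
Proof.
move=> Au; rewrite /lie_bracket /conj_mx mulmxBr mulmxBl.
by congr (_ - _); rewrite !mulmxA mulmxKV.
Qed.

Lemma intertwiner_conj A x y : A \in unitmx ->
  y *m A = A *m x -> conj_mx A x = y.
Proof. by move=> Au yA; rewrite /conj_mx -yA mulmxK. Qed.

Lemma sl2_h_involution : sl2_h *m sl2_h = 1%:M :> 'M[R[i]]_2.
Proof. by apply: matrix2P; split; rewrite mulmx2E !mxE /=; ring. Qed.

Lemma bracket_e1_e2 : lie_bracket sl2_e1 sl2_e2 = sl2_h :> 'M[R[i]]_2.
Proof. by rewrite /lie_bracket !mul_delta_mx. Qed.

Lemma bracket_h_e1 : lie_bracket sl2_h sl2_e1 = 2 *: sl2_e1 :> 'M[R[i]]_2.
Proof.
by apply: matrix2P; split; rewrite /lie_bracket !(mulmx2E, mxE) /=; ring.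
Qed.

Lemma bracket_h_e2 : lie_bracket sl2_h sl2_e2 = - 2 *: sl2_e2 :> 'M[R[i]]_2.
Proof.
by apply: matrix2P; split; rewrite /lie_bracket !(mulmx2E, mxE) /=; ring.
Qed.

Lemma conj_sl2_h_exists (g : 'M[R[i]]_2) : g \in sl2 -> \det g = -1 ->
  exists A, A \in unitmx /\ conj_mx A sl2_h = g.
Proof.
rewrite inE => /eqP tr_g det_g.
have gg : g *m g = 1%:M by rewrite sqr_traceless2 // det_g opprK.
suff [M Mu] : exists M : 'M_2, M + g *m M *m sl2_h \in unitmx.
  exists (M + g *m M *m sl2_h); split=> //.
  apply: intertwiner_conj => //.
  exact: intertwiner_involutions gg sl2_h_involution.
have g11 : g 1 1 = - g 0 0.
  by apply/eqP; rewrite -addr_eq0 addrC -mxtrace2E tr_g.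
have bc : g 0 1 * g 1 0 = 1 - g 0 0 * g 0 0.
  by move: det_g; rewrite det2E g11 => /eqP; rewrite subr_eq => /eqP E; ring: E.
have [a1|a_neq] := eqVneq (g 0 0) (-1).
  exists (sl2_e1 + sl2_e2).
  have -> : (sl2_e1 + sl2_e2 + g *m (sl2_e1 + sl2_e2) *m sl2_h \in unitmx)
      = (- 2 * (1 - g 0 0) != 0).
    rewrite unitmxE unitfE det2E; congr (_ != 0).
    by rewrite !(mulmx2E, mxE) /= g11; ring: bc.
  by rewrite a1 mulf_neq0 ?oppr_eq0 ?pnatr_eq0 // opprK (pnatr_eq0 _ 2).
exists 1%:M.
have -> : (1%:M + g *m 1%:M *m sl2_h \in unitmx) = (2 * (1 + g 0 0) != 0).
  rewrite unitmxE unitfE mulmx1 det2E; congr (_ != 0).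
  by rewrite !(mulmx2E, mxE) /= g11; ring: bc.
by rewrite mulf_neq0 ?pnatr_eq0 // addrC addr_eq0.
Qed.

End Conjugation.

Theorem theorem2p1 (R : realType) (h' : 'M[R[i]]_2) :
  h' \in sl2 -> \det h' = -1 ->
  (exists A : 'M[R[i]]_2, A \in unitmx /\ conj_mx A sl2_h = h') /\
  (forall A : 'M[R[i]]_2, A \in unitmx -> conj_mx A sl2_h = h' ->
    let e1' := conj_mx A sl2_e1 in
    let e2' := conj_mx A sl2_e2 in
    [/\ lie_bracket e1' e2' = h',
        lie_bracket h' e1' = 2 *: e1' &
        lie_bracket h' e2' = - 2 *: e2']).
Proof.
move=> h'_sl2 det_h'; split; first exact: conj_sl2_h_exists.
move=> A Au <- e1' e2'; rewrite /e1' /e2' !lie_bracket_conj //.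
by rewrite bracket_e1_e2 bracket_h_e1 bracket_h_e2 !conj_mxZ.
Qed.
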